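(* Every $3$-Lie superalgebra over $\mathbb{C}$ whose super vector space dimension is $0|1$ or $1|1$ is Abelian.
   Context: A super vector space $V = V_{\overline 0} \oplus V_{\overline 1}$ has dimension $m|n$ if $\dim V_{\overline 0}=m$ and $\dim V_{\overline 1}=n$. A homogeneous element $x$ has parity $|x|=\overline 0$ if $x\in V_{\overline 0}$ and $|x|=\overline 1$ if $x\in V_{\overline 1}$. A $3$-Lie superalgebra over $\mathbb{C}$ is a super vector space $\mathfrak{g}$ over $\mathbb{C}$ with a trilinear map $[\cdot,\cdot,\cdot]:\mathfrak{g}^3\to\mathfrak{g}$ such that for all homogeneous elements: (1) $|[x_1,x_2,x_3]| = |x_1|+|x_2|+|x_3|$; (2) $[x_1,x_2,x_3] = -(-1)^{|x_1||x_2|}[x_2,x_1,x_3]$ and $[x_1,x_2,x_3] = -(-1)^{|x_2||x_3|}[x_1,x_3,x_2]$; (3) $[y_1,y_2,[x_1,x_2,x_3]] = [[y_1,y_2,x_1],x_2,x_3] + (-1)^{|x_1|(|y_1|+|y_2|)}[x_1,[y_1,y_2,x_2],x_3] + (-1)^{(|x_1|+|x_2|)(|y_1|+|y_2|)}[x_1,x_2,[y_1,y_2,x_3]]$. It is Abelian if its bracket is identically zero. *)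

(* Defs.v *)
From HB Require Import structures.
From mathcomp Require Import all_boot all_order all_algebra.
From mathcomp Require Import reals complex.

Set Implicit Arguments.
Unset Strict Implicit.
Unset Printing Implicit Defensive.

Import GRing.Theory.
Local Open Scope ring_scope.

(* Parities are booleans: false is even, true is odd; addition in Z/2 is (+)
   and multiplication is &&. The zero vector lies in both parts, so "x is
   homogeneous of parity a" is rendered as x \in super_part V a. *)
Record superSpace (K : fieldType) := SuperSpace {
  super_carrier :> vectType K;
  super_part : bool -> {vspace super_carrier};
  super_sum : (super_part false + super_part true)%VS = fullv;
  super_direct : directv (super_part false + super_part true)%VS
}.

Definition has_superdim (K : fieldType) (V : superSpace K) (m n : nat) : Prop :=
  \dim (super_part V false) = m /\ \dim (super_part V true) = n.

Definition trilinear (K : fieldType) (V : lmodType K)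
    (br : V -> V -> V -> V) : Prop :=
  [/\ forall y z, linear (fun x => br x y z),
      forall x z, linear (fun y => br x y z) &
      forall x y, linear (fun z => br x y z)].

Record lie3Superalgebra (K : fieldType) := Lie3Superalgebra {
  lie3_space :> superSpace K;
  bracket : lie3_space -> lie3_space -> lie3_space -> lie3_space;
  bracket_trilinear : trilinear bracket;
  bracket_parity : forall (a1 a2 a3 : bool) (x1 x2 x3 : lie3_space),
    x1 \in super_part lie3_space a1 ->
    x2 \in super_part lie3_space a2 ->
    x3 \in super_part lie3_space a3 ->
    bracket x1 x2 x3 \in super_part lie3_space (a1 (+) a2 (+) a3);
  bracket_skew12 : forall (a1 a2 a3 : bool) (x1 x2 x3 : lie3_space),
    x1 \in super_part lie3_space a1 ->
    x2 \in super_part lie3_space a2 ->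
    x3 \in super_part lie3_space a3 ->
    bracket x1 x2 x3 = - ((-1) ^+ (a1 && a2) *: bracket x2 x1 x3);
  bracket_skew23 : forall (a1 a2 a3 : bool) (x1 x2 x3 : lie3_space),
    x1 \in super_part lie3_space a1 ->
    x2 \in super_part lie3_space a2 ->
    x3 \in super_part lie3_space a3 ->
    bracket x1 x2 x3 = - ((-1) ^+ (a2 && a3) *: bracket x1 x3 x2);
  bracket_jacobi : forall (b1 b2 a1 a2 a3 : bool)
      (y1 y2 x1 x2 x3 : lie3_space),
    y1 \in super_part lie3_space b1 ->
    y2 \in super_part lie3_space b2 ->
    x1 \in super_part lie3_space a1 ->
    x2 \in super_part lie3_space a2 ->
    x3 \in super_part lie3_space a3 ->
    bracket y1 y2 (bracket x1 x2 x3) =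
      bracket (bracket y1 y2 x1) x2 x3
      + (-1) ^+ (a1 && (b1 (+) b2)) *: bracket x1 (bracket y1 y2 x2) x3
      + (-1) ^+ ((a1 (+) a2) && (b1 (+) b2))
          *: bracket x1 x2 (bracket y1 y2 x3)
}.

Definition is_abelian (K : fieldType) (g : lie3Superalgebra K) : Prop :=
  forall x y z : g, bracket x y z = 0.

(* Main.v *)
Require Import Defs.
From mathcomp Require Import all_boot all_order all_algebra.
From mathcomp Require Import reals complex.

(** In both dimensions the even part is spanned by one vector e (zero in
    dimension 0|1) and the odd part by one vector f, so by trilinearity it
    suffices that the bracket vanishes on the triples made of e and f.  It is
    alternating in even arguments, so a triple in which e occurs twice gives
    zero as soon as 2 is invertible.  By super-skew-symmetry and parity the
    remaining triples reduce to <e, f, f> = a e and <f, f, f> = b f, where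
    <x, y, z> stands for the bracket.  The fundamental identity, with
    x1 = x2 = x3 = f, determines both scalars:
    - for y1 = y2 = f all signs are +, and it reads b^2 f = 3 b^2 f, so
      <f, f, f> = 0 ([bracket_ooo]);
    - for y1 = e and y2 = f the left side <e, f, b f> is now zero, and the right
      side is 3 a^2 e, so <e, f, f> = 0 ([bracket_eoo]).
    The argument holds over every field in which 2 and 3 are invertible. *)

Set Implicit Arguments.
Unset Strict Implicit.
Unset Printing Implicit Defensive.

Import GRing.Theory Num.Theory.
Local Open Scope ring_scope.

Lemma dim_le1_line (K : fieldType) (V : vectType K) (U : {vspace V}) :
  (\dim U <= 1)%N -> exists u, U = <[u]>%VS.
Proof.
move=> dimU; exists (vpick U); apply/esym/eqP.
rewrite eqEdim -memvE memv_pick /= dim_vline vpick0.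
by have [->|_] := eqVneq U 0%VS; rewrite ?dimv0.
Qed.

Lemma linear_eq0_of_generators (K : fieldType) (V W : lmodType K) (e f : V)
    (h : V -> W) :
  (forall x : V, exists c d : K, x = c *: e + d *: f) -> linear h ->
  h e = 0 -> h f = 0 -> forall x, h x = 0.
Proof.
move=> gen lin_h he hf x; have [c [d ->]] := gen x.
by rewrite lin_h (scalable_linear lin_h) /= he hf !scaler0 addr0.
Qed.

Section Lie3.
Variables (K : fieldType) (g : lie3Superalgebra K).
Implicit Types x y z : g.

Lemma bracketZ1 a x y z : bracket (a *: x) y z = a *: bracket x y z.
Proof. by have [lin _ _] := bracket_trilinear g; exact: (scalable_linear (lin y z)). Qed.

Lemma bracketZ2 a x y z : bracket x (a *: y) z = a *: bracket x y z.
Proof. by have [_ lin _] := bracket_trilinear g; exact: (scalable_linear (lin x z)). Qed.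

Lemma bracketZ3 a x y z : bracket x y (a *: z) = a *: bracket x y z.
Proof. by have [_ _ lin] := bracket_trilinear g; exact: (scalable_linear (lin x y)). Qed.

Hypotheses (two_neq0 : 2 != 0 :> K) (three_neq0 : 3 != 0 :> K).

Lemma eq_opp0 x : x = - x -> x = 0.
Proof.
move=> /eqP; rewrite -subr_eq0 opprK -mulr2n -scaler_nat scaler_eq0.
by rewrite (negPf two_neq0) => /eqP.
Qed.

Variables e f : g.
Hypotheses (even_line : super_part g false = <[e]>%VS)
           (odd_line : super_part g true = <[f]>%VS).

Lemma even_e : e \in super_part g false.
Proof. by rewrite even_line memv_line. Qed.

Lemma odd_f : f \in super_part g true.
Proof. by rewrite odd_line memv_line. Qed.

Let ev := even_e.
Let od := odd_f.

Lemma generators x : exists c d : K, x = c *: e + d *: f.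
Proof.
have : x \in (super_part g false + super_part g true)%VS.
  by rewrite super_sum memvf.
rewrite even_line odd_line => /memv_addP[u /vlineP[c ->] [v /vlineP[d ->] ->]].
by exists c, d.
Qed.

Lemma bracket_eex a z : z \in super_part g a -> bracket e e z = 0.
Proof.
by move=> zP; apply: eq_opp0; rewrite {1}(bracket_skew12 ev ev zP) scale1r.
Qed.

Lemma bracket_xee a x : x \in super_part g a -> bracket x e e = 0.
Proof.
by move=> xP; apply: eq_opp0; rewrite {1}(bracket_skew23 xP ev ev) scale1r.
Qed.

Lemma bracket_efe : bracket e f e = 0.
Proof. by rewrite (bracket_skew23 ev od ev) (bracket_eex od) scaler0 oppr0. Qed.

Lemma bracket_fef : bracket f e f = - bracket e f f.
Proof. by rewrite (bracket_skew12 od ev od) scale1r. Qed.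

Lemma bracket_ffe : bracket f f e = bracket e f f.
Proof. by rewrite (bracket_skew23 od od ev) scale1r bracket_fef opprK. Qed.

(** The even derivation <f, f, _> multiplies f by b.  Applied to
    <f, f, f> = b f, it gives b^2 f directly and, by the Leibniz rule, one such
    term for each of the three arguments; hence 2 b^2 f = 0. *)
Lemma bracket_ooo : bracket f f f = 0.
Proof.
have := bracket_parity od od od; rewrite /= odd_line => /vlineP[b defb].
have := bracket_jacobi od od od od od.
rewrite /= !expr0 !scale1r defb bracketZ1 bracketZ2 bracketZ3 defb.
set w := b *: (b *: f) => w3.
have /eqP : 2 *: w = 0.
  by apply/(addrI w); rewrite scaler_nat mulr2n addr0 {4}w3 addrA.
rewrite scaler_eq0 (negPf two_neq0) /= !scaler_eq0 orbA orbb.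
by move=> /orP[/eqP->|/eqP->]; rewrite ?scale0r ?scaler0.
Qed.

(** The odd derivation D = <e, f, _> sends f to a e.  The Leibniz rule for
    D <f, f, f> = 0 gives the terms a <e, f, f>, - a <f, e, f> and a <f, f, e>:
    the sign from moving D past the first f cancels the one that skew-symmetry
    produces, so the three terms add up to 3 a^2 e instead of cancelling. *)
Lemma bracket_eoo : bracket e f f = 0.
Proof.
have := bracket_parity ev od od; rewrite /= even_line => /vlineP[a defa].
have := bracket_jacobi ev od od od od.
rewrite /= expr1 expr0 bracket_ooo scale1r scaleN1r.
(* The left side is the bracket of e, f and 0, with 0 seen as 0 *: e. *)
rewrite -[0 in LHS](scale0r e) bracketZ3 scale0r.
rewrite defa bracketZ1 bracketZ2 bracketZ3 bracket_fef bracket_ffe defa.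
rewrite scalerN opprK => /esym/eqP.
rewrite -mulr2n -mulrSr -scaler_nat scaler_eq0 (negPf three_neq0) /=.
rewrite !scaler_eq0 orbA orbb.
by move=> /orP[/eqP->|/eqP->]; rewrite ?scale0r ?scaler0.
Qed.

(** The lines may be zero, since e and f are not assumed nonzero: this is what
    treats the dimensions 0|1 and 1|1 together. *)
Lemma abelian_of_lines : is_abelian g.
Proof.
have [lin1 lin2 lin3] := bracket_trilinear g.
have gen := linear_eq0_of_generators generators.
move=> x y z; move: x; apply: (gen _ _ (lin1 y z)); move: y;
  apply: (gen _ _ (lin2 _ z)); move: z; apply: (gen _ _ (lin3 _ _)).
- exact: bracket_eex ev.
- exact: bracket_eex od.
- exact: bracket_efe.
- exact: bracket_eoo.
- exact: bracket_xee od.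
- by rewrite bracket_fef bracket_eoo oppr0.
- by rewrite bracket_ffe bracket_eoo.
- exact: bracket_ooo.
Qed.

End Lie3.

Theorem theorem3 (R : realType) (g : lie3Superalgebra (complex R)) :
  has_superdim g 0 1 \/ has_superdim g 1 1 -> is_abelian g.
Proof.
move=> dim_g.
have [e even_line] : exists e, super_part g false = <[e]>%VS.
  by apply: dim_le1_line; case: dim_g => -[-> _].
have [f odd_line] : exists f, super_part g true = <[f]>%VS.
  by apply: dim_le1_line; case: dim_g => -[_ ->].
by apply: (abelian_of_lines _ _ even_line odd_line); rewrite pnatr_eq0.
Qed.
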